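(* Let $x:\mathcal{D}\to\mathbb{C}$ be holomorphic on the open unit disc with $x'$ nowhere zero, and let $\Phi=x(z)$, i.e. $\Phi(z)=[1:x(z)]$, be the corresponding curve in $\mathbb{CP}^1$, with Schwarzian curvature $\kappa_0$. Let $z=z(w)$ be a holomorphic change of coordinates, i.e. an injective holomorphic map $z:\Omega\to\mathcal{D}$ from an open disc $\Omega\subset\mathbb{C}$, and let $\tilde\kappa_0$ be the Schwarzian curvature of the reparametrized curve $\tilde\Phi(w)=\Phi(z(w))$ on $\Omega$. Then for all $w\in\Omega$ $$\tilde\kappa_0(w)=z'(w)^2\,\kappa_0(z(w))-\frac12\,(Sz)(w),$$ where $Sz=\dfrac{z'''}{z'}-\dfrac32\left(\dfrac{z''}{z'}\right)^2$ is the Schwarzian derivative of $z(w)$.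
   Context: For a curve $\Phi$ from an open disc $U\subset\mathbb{C}$ to $\mathbb{CP}^1$ with holomorphic lifting $f:U\to\mathbb{C}^2\setminus\{0\}$ such that $f,f'$ are pointwise linearly independent, choose a holomorphic $\lambda:U\to\mathbb{C}\setminus\{0\}$ with $\lambda^2\det[f,f']=1$ and put $\nu=\lambda f$, so that $\det[\nu,\nu']=1$. Then $\det[\nu,\nu'']=0$, so there is a unique holomorphic function $\kappa_0$ on $U$ with $\nu''=\kappa_0\nu$; it is the Schwarzian curvature of $\Phi$ (it does not depend on the choice of $f$ and $\lambda$). Derivatives are taken with respect to the coordinate on the domain of the curve. *)

(* Defs.v *)
From HB Require Import structures.
From mathcomp Require Import all_boot all_order all_algebra.
From mathcomp Require Import classical_sets boolp reals topology normedtype derive.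
From mathcomp Require Import complex.

Set Implicit Arguments.
Unset Strict Implicit.
Unset Printing Implicit Defensive.

Import Order.TTheory GRing.Theory Num.Theory.
Import numFieldNormedType.Exports.

Local Open Scope classical_set_scope.
Local Open Scope ring_scope.

(* Typed as a numFieldType so that the complex numbers get their norm topology
   and normed module structure over themselves; [derivable f z 1] and
   [derive1 f z] are then the complex differentiability and the complex
   derivative. In this order 0 < r means that r is a positive real, so that
   [ball c r] with 0 < r is an open disc. *)
Definition Cplx (R : realType) : numFieldType := R[i].

Definition holomorphic (R : realType) (V : normedModType (Cplx R))
  (U : set (Cplx R)) (f : Cplx R -> V) : Prop :=
  forall z, U z -> derivable f z 1.

(* The points of CP^1 are the lines through the origin of C^2. *)
Record CP1 (R : realType) := MkCP1 {
  cp1_line : {vspace 'cV[Cplx R]_2};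
  cp1_dim : \dim cp1_line == 1%N
}.

Definition affine_coord (R : realType) (a : Cplx R) : 'cV[Cplx R]_2 :=
  \col_(i < 2) (if i == 0 then 1 else a).

Fact affine_coord_dim (R : realType) (a : Cplx R) :
  \dim <[affine_coord a]> == 1%N.
Proof.
rewrite dim_vline eqb1; apply/eqP => /matrixP /(_ 0 0).
by rewrite !mxE /= => /eqP; rewrite oner_eq0.
Qed.

(* The point [1 : a]. *)
Definition affine_point (R : realType) (a : Cplx R) : CP1 R :=
  MkCP1 (affine_coord_dim a).

Definition holomorphic_lift (R : realType) (U : set (Cplx R))
  (Phi : Cplx R -> CP1 R) (f : Cplx R -> 'cV[Cplx R]_2) : Prop :=
  holomorphic U f /\
  forall z, U z -> f z != 0 /\ cp1_line (Phi z) = <[f z]>%VS.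

Definition det2 (R : realType) (u v : 'cV[Cplx R]_2) : Cplx R :=
  \det (row_mx u v : 'M[Cplx R]_2).

(* [kappa] is, on the open set [U], the Schwarzian curvature of [Phi]; since it
   does not depend on the lift [f] and the scaling [lam], one such pair is
   asked for. *)
Definition schwarzian_curvature (R : realType) (U : set (Cplx R))
  (Phi : Cplx R -> CP1 R) (kappa : Cplx R -> Cplx R) : Prop :=
  holomorphic U kappa /\
  exists (f : Cplx R -> 'cV[Cplx R]_2) (lam : Cplx R -> Cplx R),
    [/\ holomorphic_lift U Phi f,
        forall z, U z -> free [:: f z; derive1 f z],
        holomorphic U lam /\ (forall z, U z -> lam z != 0),
        forall z, U z -> lam z ^+ 2 * det2 (f z) (derive1 f z) = 1
      & let nu := fun z => lam z *: f z in
        forall z, U z -> is_derive z 1 (derive1 nu) (kappa z *: nu z)].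

Definition schwarzian (R : realType) (h : Cplx R -> Cplx R) (w : Cplx R) :
    Cplx R :=
  derive1n 3 h w / derive1 h w - 3 / 2 * (derive1n 2 h w / derive1 h w) ^+ 2.

(* Main.v *)
(* Since Phi = [1 : x], the normalized lift is nu = g (1, x) with g^2 x' = 1 and
   g'' = kappa0 g. Likewise gt^2 (x o z)' = 1 and gt'' = kappa0t gt for the
   reparametrized curve, whence z' = (g o z / gt)^2. This makes z' differentiable
   as often as needed without Cauchy's theory. With u = (g' / g) o z and
   v = gt' / gt one has z'' = 2 z' (u z' - v), while u and v satisfy the Riccati
   equations u' = z' (kappa0 o z - u^2) and v' = kappa0t - v^2; substituting
   these in the Schwarzian derivative gives Sz = 2 (z'^2 kappa0 o z - kappa0t). *)
Require Import Defs.
From mathcomp Require Import all_boot all_order all_algebra.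
From mathcomp Require Import classical_sets boolp reals topology normedtype derive.
From mathcomp Require Import complex.
From mathcomp Require Import functions ring.

Set Implicit Arguments.
Unset Strict Implicit.
Unset Printing Implicit Defensive.

Import Order.TTheory GRing.Theory Num.Theory.
Import numFieldNormedType.Exports.

Local Open Scope classical_set_scope.
Local Open Scope ring_scope.

Lemma near_mem (K : numFieldType) (U : set K) z :
  open U -> U z -> \forall x \near z, U x.
Proof. by move=> oU Uz; exact: open_nbhs_nbhs. Qed.

Lemma is_derive1_comp_num (K : numFieldType) (f g : K -> K) (x df dg : K) :
  is_derive x 1 f df -> is_derive (f x) 1 g dg ->
  is_derive x 1 (g \o f) (dg * df).
Proof.
move=> [/derivable1_diffP fx <-] [/derivable1_diffP gx <-].
apply: DeriveDef; first exact/derivable1_diffP/differentiable_comp.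
rewrite -!derive1E derive1E'; last exact/differentiable_comp.
rewrite diff_comp // !derive1E' //= -[X in 'd  _ _ X = _]mulr1.
by rewrite [LHS]linearZ mulrC.
Qed.

Lemma derivable_is_derive1 (K : numFieldType) (V : normedModType K) (f : K -> V)
    (x : K) : derivable f x 1 -> is_derive x 1 f (derive1 f x).
Proof. by move=> fx; rewrite derive1E; exact: derivableP. Qed.

Lemma is_derive_div (K : numFieldType) (f g : K -> K) (x df dg : K) :
  g x != 0 -> is_derive x 1 f df -> is_derive x 1 g dg ->
  is_derive x 1 (fun y => f y / g y) ((df * g x - f x * dg) / g x ^+ 2).
Proof.
move=> gx0 fx gx.
have ix : is_derive x 1 (fun y => (g y)^-1) (- (g x) ^- 2 * dg).
  case: gx => gx <-; apply: DeriveDef; first exact: derivableV.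
  by rewrite deriveV.
apply: is_derive_eq (is_deriveM fx ix) _.
by rewrite /GRing.scale /=; field.
Qed.

(** Taking an entry is linear and continuous, so it commutes with difference quotients and passes to
    their limit. *)
Lemma is_derive_mx_coord (K : numFieldType) (V : normedModType K) (m n : nat)
    (M : V -> 'M[K]_(m, n)) (t v : V) (dM : 'M[K]_(m, n)) i j :
  is_derive t v M dM -> is_derive t v (fun s => M s i j) (dM i j).
Proof.
move=> [Mt <-].
have cM : (fun h => (h^-1 *: (M (h *: v + t) - M t)) i j) @ 0^' -->
    ('D_v M t) i j.
  apply: (@cvg_comp _ _ _ _ (fun A : 'M[K]_(m, n) => A i j) _ _ _ Mt).
  exact: coord_continuous.
have eqM : (fun h : K => (h^-1 *: (M (h *: v + t) - M t)) i j) =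
    fun h => h^-1 *: (M (h *: v + t) i j - M t i j).
  by apply/funext => h; rewrite !mxE.
rewrite eqM in cM.
apply: DeriveDef; last exact: cvg_lim cM.
by apply/cvg_ex; exists (('D_v M t) i j).
Qed.

(** A matrix function is the finite sum of its entries times the constant matrices
    [delta_mx i j]. *)
Lemma derivable_mx_coords (K : numFieldType) (V : normedModType K) (m n : nat)
    (M : V -> 'M[K]_(m, n)) (t v : V) :
  (forall i j, derivable (fun s => M s i j) t v) -> derivable M t v.
Proof.
move=> dM.
suff -> : M = \sum_(i < m) \sum_(j < n)
    ((fun s => M s i j *: delta_mx i j) : V -> 'M[K]_(m, n)).
  apply: derivable_sum => i; apply: derivable_sum => j.
  (* Restricted to the line through [t] in direction [v], the entry has a scalar variable, where
     derivability amounts to differentiability. *)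
  have /derivable1P/derivable1_diffP dMij := dM i j.
  by apply/derivable1P/derivable1_diffP; exact: differentiableZl.
apply/funext => s; rewrite fct_sumE [LHS]matrix_sum_delta.
by apply: eq_bigr => i _; rewrite fct_sumE.
Qed.

(** The curve is eliminated: only the scalings [g] and [gt] remain. First-order data on all of [U]
    give z'' there; the second-order equations, at [w] only, then give z''' at [w]. *)
Lemma schwarzian_projective (K : numFieldType) (U : set K) (z g gt : K -> K)
    (w k kt : K) :
  open U -> U w ->
  (forall s, U s ->
     [/\ derivable z s 1, derivable g (z s) 1 & derivable gt s 1]) ->
  (forall s, U s -> g (z s) != 0 /\ gt s != 0) ->
  (forall s, U s -> derive1 z s = (g (z s) / gt s) ^+ 2) ->
  is_derive (z w) 1 (derive1 g) (k * g (z w)) ->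
  is_derive w 1 (derive1 gt) (kt * gt w) ->
  derive1n 3 z w / derive1 z w - 3 / 2 * (derive1n 2 z w / derive1 z w) ^+ 2 =
  2 * (derive1 z w ^+ 2 * k - kt).
Proof.
move=> oU Uw dU nzU zE dg dgt.
pose u s := derive1 g (z s) / g (z s).
pose v s := derive1 gt s / gt s.
have dgz s : U s -> is_derive s 1 (g \o z) (derive1 g (z s) * derive1 z s).
  by move=> /dU[zs gs _]; apply: is_derive1_comp_num; exact: derivable_is_derive1.
have dz' s : U s ->
    is_derive s 1 (derive1 z) (2 * derive1 z s * (u s * derive1 z s - v s)).
  move=> Us; have [zs gs gts] := dU _ Us; have [g0 gt0] := nzU _ Us.
  have qs := is_derive_div gt0 (dgz _ Us) (derivable_is_derive1 gts).
  (* The formula for z' holds on [U], hence near [s], which is enough to differentiate it at [s].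
     The logarithmic derivative of its right-hand side is 2 (u z' - v). *)
  apply: (@near_eq_is_derive _ _ _ ((fun y => (g \o z) y / gt y) ^+ 2)).
    near=> y; rewrite /= exprfctE/= zE//.
    by near: y; exact: near_mem.
  apply: is_derive_eq (is_deriveX 2 qs) _.
  rewrite /GRing.scale /= /u /v zE //.
  by field; rewrite g0 gt0.
have z2 s : U s -> derive1n 2 z s = 2 * derive1 z s * (u s * derive1 z s - v s).
  by move=> /dz' [_ <-]; rewrite derive1nS derive1n1 derive1E.
have [zw gw gtw] := dU _ Uw; have [g0 gt0] := nzU _ Uw.
have du : is_derive w 1 u (derive1 z w * (k - u w ^+ 2)).
  have := is_derive_div (g := g \o z) g0
    (is_derive1_comp_num (derivable_is_derive1 zw) dg) (dgz _ Uw).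
  move/is_derive_eq; apply; rewrite /u /=.
  by field.
have dv : is_derive w 1 v (kt - v w ^+ 2).
  have := is_derive_div gt0 dgt (derivable_is_derive1 gtw).
  by move/is_derive_eq; apply; rewrite /v; field.
have z3 : derive1n 3 z w = 2 * derive1n 2 z w * (u w * derive1 z w - v w) +
    2 * derive1 z w * (derive1 z w * (k - u w ^+ 2) * derive1 z w +
      u w * derive1n 2 z w - (kt - v w ^+ 2)).
  rewrite derive1nS derive1E.
  set d := (X in _ = X); suff [_ <-] : is_derive w 1 (derive1n 2 z) d by [].
  apply: (@near_eq_is_derive _ _ _ (cst 2 * (derive1 z) * (u * (derive1 z) - v))).
    by near=> y; rewrite z2//; near: y; exact: near_mem.
  have dzw := dz' _ Uw; rewrite -z2 // in dzw.
  apply: is_derive_eq; rewrite /d /GRing.scale /= !fctE /=.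
  by ring.
(* With q = u z' - v one has z''/z' = 2 q and z'''/z' = 6 q^2 + 2 (z'^2 k - kt), so the squares of q
   cancel in the Schwarzian derivative. *)
rewrite z3 z2 //.
have z'0 : derive1 z w != 0 by rewrite zE// expf_neq0// mulf_neq0// invr_neq0.
by field.
Unshelve. all: by end_near. Qed.

Lemma det2E (R : realType) (a b : 'cV[Cplx R]_2) :
  det2 a b = a 0 0 * b 1 0 - a 1 0 * b 0 0.
Proof.
have M0 i : (row_mx a b : 'M_2) i 0 = a i 0.
  by rewrite -(row_mxEl a b); congr fun_of_matrix; exact: val_inj.
have M1 i : (row_mx a b : 'M_2) i 1 = b i 0.
  by rewrite -(row_mxEr a b); congr fun_of_matrix; exact: val_inj.
have l01 : lift 0 0 = 1 :> 'I_2 by exact: val_inj.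
have l10 : lift 1 0 = 0 :> 'I_2 by exact: val_inj.
rewrite /det2; move: (row_mx a b) M0 M1 => A M0 M1.
rewrite (expand_det_row _ 0) !big_ord_recl big_ord0 /cofactor !det_mx11.
rewrite !mxE !l01 !l10 !M0 !M1 /= expr0 expr1.
by ring.
Qed.

(** Any lift of [1 : y] has the form f = f_0 (1, y), so det[f, f'] = f_0^2 y'. Hence [g] = lam f_0,
    the first coordinate of the normalized lift, carries both the normalization and the second-order
    equation. *)
Lemma schwarzian_curvature_affine (R : realType) (U : set (Cplx R))
    (y kappa : Cplx R -> Cplx R) :
  open U -> holomorphic U y ->
  schwarzian_curvature U (fun s => affine_point (y s)) kappa ->
  exists g : Cplx R -> Cplx R,
    forall s, U s -> [/\ derivable g s 1, g s ^+ 2 * derive1 y s = 1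
      & is_derive s 1 (derive1 g) (kappa s * g s)].
Proof.
move=> oU hy [_ [f [lam [[hf fP] _ [hlam _] detP nuP]]]].
exists (fun s => lam s * f s 0 0) => s Us.
have fE t : U t -> f t 1 0 = f t 0 0 * y t.
  move=> Ut; have [_ /= ft] := fP t Ut.
  have /vlineP[a ->] : f t \in <[affine_coord (y t)]>%VS by rewrite ft memv_line.
  by rewrite !mxE /= mulr1.
have df t i : U t -> is_derive t 1 (fun s => f s i 0) ((derive1 f t) i 0).
  move=> Ut; apply: is_derive_mx_coord; apply: derivable_is_derive1.
  exact: hf.
have dnu t : U t -> derivable (fun s => lam s *: f s) t 1.
  move=> Ut; apply: derivable_mx_coords => i j; rewrite ord1.
  have -> : (fun s => (lam s *: f s) i 0) = lam * (fun s => f s i 0).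
    by apply/funext => r; rewrite mxE.
  by apply: derivableM; [exact: hlam|by have [] := df t i Ut].
have dg t : U t -> derivable (fun s => lam s * f s 0 0) t 1.
  by move=> Ut; apply: derivableM; [exact: hlam|by have [] := df t 0 Ut].
split; first exact: dg.
- have /= := detP s Us.
  have f1 : (derive1 f s) 1 0 = (derive1 f s) 0 0 * y s + f s 0 0 * derive1 y s.
    have [_ <-] := df s 1 Us.
    suff [_ <-] : is_derive s 1 (fun t => f t 1 0)
       ((derive1 f s) 0 0 * y s + f s 0 0 * derive1 y s) by [].
    apply: (@near_eq_is_derive _ _ _ ((fun t => f t 0 0) * y)).
      by near=> t; rewrite fE//; near: t; exact: near_mem.
    apply: is_derive_eq (is_deriveM (df s 0 Us) (derivable_is_derive1 (hy s Us))) _.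
    by rewrite /GRing.scale /=; ring.
  rewrite det2E f1 fE // => <-.
  ring.
(* The first coordinate of nu'' = kappa nu. It remains to identify the first coordinate of nu' with
   g' near [s], which uses the differentiability of nu. *)
- have := nuP s Us => /(@is_derive_mx_coord _ _ _ _ _ _ _ _ 0 0).
  rewrite mxE mxE mulrA; apply: near_eq_is_derive.
  near=> t.
  have Ut : U t by near: t; exact: near_mem.
  have := dnu t Ut => /derivableP /(@is_derive_mx_coord _ _ _ _ _ _ _ _ 0 0).
  rewrite -derive1E => -[_ <-]; rewrite derive1E; congr ('D_1 _ t).
  by apply/funext => r; rewrite mxE.
Unshelve. all: by end_near. Qed.

(** Eliminates p, the derivative of x at z(w), between the two normalizations: q = a^2 p q, while p
    q = 1 / b^2. *)
Lemma quotient_sqr (K : fieldType) (a b p q : K) :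
  b != 0 -> a ^+ 2 * p = 1 -> b ^+ 2 * (p * q) = 1 -> q = (a / b) ^+ 2.
Proof.
move=> b0 ap bpq; rewrite expr_div_n -[LHS]mul1r -ap.
apply: (canRL (mulfK _)); first by rewrite expf_neq0.
by rewrite -[RHS]mulr1 -bpq; ring.
Qed.

Lemma half_double (K : numFieldType) (a b : K) : b = a - 1 / 2 * (2 * (a - b)).
Proof. by field. Qed.

Theorem theorem4p7 (R : realType)
  (x : Cplx R -> Cplx R)
  (hx : holomorphic (ball (0 : Cplx R) 1) x)
  (hx' : forall z : Cplx R, ball (0 : Cplx R) 1 z -> derive1 x z != 0)
  (kappa0 : Cplx R -> Cplx R)
  (hkappa0 : schwarzian_curvature (ball (0 : Cplx R) 1)
     (fun z => affine_point (x z)) kappa0)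
  (c r : Cplx R) (hr : 0 < r)
  (z : Cplx R -> Cplx R)
  (hz : holomorphic (ball c r) z)
  (hz_inj : forall w1 w2 : Cplx R,
     ball c r w1 -> ball c r w2 -> z w1 = z w2 -> w1 = w2)
  (hz_maps : forall w : Cplx R, ball c r w -> ball (0 : Cplx R) 1 (z w))
  (kappa0t : Cplx R -> Cplx R)
  (hkappa0t : schwarzian_curvature (ball c r)
     (fun w => affine_point (x (z w))) kappa0t) :
  forall w : Cplx R, ball c r w ->
    kappa0t w = derive1 z w ^+ 2 * kappa0 (z w) - 1 / 2 * schwarzian z w.
Proof.
move=> w Bw.
have dxz s : ball c r s -> is_derive s 1 (x \o z) (derive1 x (z s) * derive1 z s).
  move=> Bs; apply: is_derive1_comp_num; apply: derivable_is_derive1; first exact: hz.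
  exact/hx/hz_maps.
have hxz : holomorphic (ball c r) (x \o z) by move=> s /dxz [].
have [g gP] := schwarzian_curvature_affine (ball_open _ _) hx hkappa0.
(* [g] and [gt] are chosen independently; their signs do not matter, since only squares and
   logarithmic derivatives enter. *)
have [gt gtP] := schwarzian_curvature_affine (ball_open _ _) hxz hkappa0t.
have [_ _ dgt] := gtP w Bw.
have [_ _ dg] := gP _ (hz_maps w Bw).
have gtE s : ball c r s -> gt s ^+ 2 * (derive1 x (z s) * derive1 z s) = 1.
  move=> Bs; have [_ <- _] := gtP s Bs; congr (_ * _).
  by have [_ <-] := dxz s Bs; rewrite derive1E.
have gE s : ball c r s -> g (z s) ^+ 2 * derive1 x (z s) = 1.
  by move=> /hz_maps/gP[].
(* The normalizations force [g] and [gt] to be nonzero. *)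
have nz (a b : Cplx R) : a ^+ 2 * b = 1 -> a != 0.
  by apply: contra_eqN => /eqP ->; rewrite expr0n mul0r eq_sym oner_eq0.
rewrite /schwarzian
  (@schwarzian_projective _ (ball c r) z g gt w _ _ _ _ _ _ _ dg dgt) //.
- exact: half_double.
- exact: ball_open.
- move=> s Bs; split; first exact: hz.
  + by have [] := gP _ (hz_maps s Bs).
  + by have [] := gtP s Bs.
- by move=> s Bs; rewrite (nz _ _ (gE s Bs)) (nz _ _ (gtE s Bs)).
- move=> s Bs; have gt0 := nz _ _ (gtE s Bs).
  exact: quotient_sqr gt0 (gE s Bs) (gtE s Bs).
Qed.
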